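(* Let $S$ and $T$ be finite sets, and let $\mathcal{V}\le\mathcal{P}(S)$ and $\mathcal{W}\le\mathcal{P}(T)$ be linear subspaces. There exists a $(\mathcal{V},\mathcal{W})$-isomorphism $S\to T$ if and only if there is a cardinality-preserving linear bijection $\mathrm{Venn}(S,\mathcal{V})\to\mathrm{Venn}(T,\mathcal{W})$.
   Context: For a finite set $S$, $\mathcal{P}(S)$ is an $\mathbb{F}_2$-vector space under symmetric difference $\triangle$ with zero $\varnothing$; $\mathcal{V}\le\mathcal{P}(S)$ means $\mathcal{V}$ is a linear subspace. A $(\mathcal{V},\mathcal{W})$-isomorphism is a bijection $g:S\to T$ such that $\{g(X):X\in\mathcal{V}\}=\mathcal{W}$. For a basis $\mathscr{X}=(X_1,\dots,X_r)$ of $\mathcal{V}$ and $\vec a\in\mathbb{F}_2^r$ with support $I_{\vec a}=\{i:a_i=1\}$, the Venn region indexed by $\vec a$ is $v_{\mathscr{X}}(\vec a)=\bigcap_{i\in I_{\vec a}}X_i\cap\bigcap_{i\notin I_{\vec a}}(S\setminus X_i)$ (regions with distinct indices are distinct, even if empty). $\mathrm{Venn}(S,\mathcal{V})$ is this indexed family, an $\mathbb{F}_2$-vector space via $v_{\mathscr{X}}(\vec a)+v_{\mathscr{X}}(\vec b)=v_{\mathscr{X}}(\vec a+\vec b)$. A cardinality-preserving linear bijection $\mathrm{Venn}(S,\mathcal{V})\to\mathrm{Venn}(T,\mathcal{W})$ means: for bases $\mathscr{X}$ of $\mathcal{V}$, $\mathscr{Y}$ of $\mathcal{W}$ of the same size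 $r$, an invertible $r\times r$ matrix $N$ over $\mathbb{F}_2$ with $|v_{\mathscr{Y}}(N\vec a)|=|v_{\mathscr{X}}(\vec a)|$ for all $\vec a\in\mathbb{F}_2^r$ (existence does not depend on the choice of bases). *)

(* Defs.v *)
From HB Require Import structures.
From mathcomp Require Import all_boot all_order all_algebra.

Set Implicit Arguments.
Unset Strict Implicit.
Unset Printing Implicit Defensive.

Import GRing.Theory.
Local Open Scope ring_scope.

(* The type {set S} itself, under a new name so that it can carry the          *)
(* F_2-vector space structure whose addition is symmetric difference.          *)
Definition powF2 (S : finType) : Type := {set S}.

Section PowerSetVectorSpace.
Variable S : finType.
Implicit Types (A B C : {set S}) (k : 'F_2).

HB.instance Definition _ := Finite.copy (powF2 S) {set S}.

Definition symdiff A B : {set S} := (A :\: B) :|: (B :\: A).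

Definition scaleF2 k A : {set S} := if k == 0 then set0 else A.

Lemma in_symdiff A B x : (x \in symdiff A B) = (x \in A) (+) (x \in B).
Proof. by rewrite !inE; case: (x \in A); case: (x \in B). Qed.

Lemma symdiffA : associative symdiff.
Proof. by move=> A B C; apply/setP => x; rewrite !in_symdiff addbA. Qed.

Lemma symdiffC : commutative symdiff.
Proof. by move=> A B; apply/setP => x; rewrite !in_symdiff addbC. Qed.

Lemma symdiff0 : left_id set0 symdiff.
Proof. by move=> A; apply/setP => x; rewrite in_symdiff inE. Qed.

Lemma symdiffN : left_inverse set0 id symdiff.
Proof. by move=> A; apply/setP => x; rewrite in_symdiff inE addbb. Qed.

HB.instance Definition _ :=
  GRing.isZmodule.Build (powF2 S) symdiffA symdiffC symdiff0 symdiffN.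

Lemma F2P k : (k = 0) \/ (k = 1).
Proof. by case: k => [[|[|[]]] // ltk]; [left|right]; apply: val_inj. Qed.

Lemma scaleF2A k l A : scaleF2 k (scaleF2 l A) = scaleF2 (k * l) A.
Proof. by case: (F2P k) => ->; case: (F2P l) => ->. Qed.

Lemma scaleF21 : left_id 1 scaleF2.
Proof. by []. Qed.

Lemma scaleF2Dr : right_distributive scaleF2 symdiff.
Proof. by move=> k A B; case: (F2P k) => ->; rewrite /scaleF2 //= symdiff0. Qed.

Lemma scaleF2Dl A : {morph scaleF2^~ A : k l / k + l >-> symdiff k l}.
Proof.
move=> k l; case: (F2P k) => ->; case: (F2P l) => ->;
  by rewrite /scaleF2 //= ?symdiff0 // ?symdiffN // symdiffC symdiff0.
Qed.

HB.instance Definition _ := GRing.Zmodule_isLmodule.Build 'F_2 (powF2 S)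
  scaleF2A scaleF21 scaleF2Dr scaleF2Dl.

Definition indicator_row (A : powF2 S) : 'rV['F_2]_#|S| :=
  \row_i (enum_val i \in (A : {set S}))%:R.

Lemma powF2_vect_axiom : Vector.axiom #|S| (powF2 S).
Proof.
exists indicator_row.
  move=> k A B; apply/rowP => i; rewrite !mxE [in LHS]in_symdiff /GRing.scale /=.
  case: (F2P k) => ->; rewrite /scaleF2 /= ?inE ?mul0r ?add0r ?mul1r //.
  by case: (_ \in _); case: (_ \in _); apply: val_inj.
exists (fun v : 'rV_#|S| => [set x | v 0 (enum_rank x) != 0] : {set S}).
  move=> A; apply/setP => x; rewrite inE mxE enum_rankK.
  by case: (x \in _).
move=> v; apply/rowP => i; rewrite mxE inE enum_valK.
by case: (F2P (v 0 i)) => ->.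
Qed.

HB.instance Definition _ := Lmodule_hasFinDim.Build 'F_2 (powF2 S)
  powF2_vect_axiom.

End PowerSetVectorSpace.

Definition is_isomorphism (S T : finType)
    (V : {vspace powF2 S}) (W : {vspace powF2 T}) (g : S -> T) : Prop :=
  bijective g /\
  [set g @: (A : {set S}) | A : powF2 S in V] = [set B : powF2 T | B \in W].

(* For r = 0 the only region is the whole of S: an empty \bigcap is setT.      *)
Definition venn (S : finType) (r : nat) (X : r.-tuple (powF2 S))
    (a : 'cV['F_2]_r) : {set S} :=
  (\bigcap_(i < r | a i 0 == 1) (tnth X i : {set S}))
    :&: \bigcap_(i < r | a i 0 != 1) ~: (tnth X i : {set S}).

(* Venn(S, V) is the family (venn X a), indexed by a in F_2^r and with the     *)
(* vector space structure of its indices, so in the bases X and Y a linear     *)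
(* bijection Venn(S, V) -> Venn(T, W) is an invertible matrix N acting on      *)
(* indices. Since the bases have the same length, dim V = dim W is implied.    *)
Definition venn_linear_bijection (S T : finType)
    (V : {vspace powF2 S}) (W : {vspace powF2 T}) : Prop :=
  exists (r : nat) (X : r.-tuple (powF2 S)) (Y : r.-tuple (powF2 T))
         (N : 'M['F_2]_r),
    [/\ basis_of V X, basis_of W Y, N \in unitmx
      & forall a : 'cV['F_2]_r, #|venn Y (N *m a)| = #|venn X a| ].

(* Main.v *)
Require Import Defs.
From HB Require Import structures.
From mathcomp Require Import all_boot all_order all_algebra.

(** Each point x of S lies in exactly one Venn region, namely the one indexed
    by its membership vector.  A bijection carrying each region of index a to
    the region of index N a pulls Y_i back to the sum of the N_ij X_j, so it
    maps V onto a space containing the basis Y of W, and dimensions agree.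
    Conversely an isomorphism transports a basis of V to a basis of W and each
    Venn region to the region with the same index. *)

Set Implicit Arguments.
Unset Strict Implicit.
Unset Printing Implicit Defensive.

Import GRing.Theory.
Local Open Scope ring_scope.

Section FiberMatching.
Variable U : eqType.

Definition fiber (S : finType) (f : S -> U) (u : U) : {set S} :=
  [set x | f x == u].

(* Matching positions in the enumerations of the fibers, rather than arbitrary
   elements, makes the two maps obtained by swapping [f] and [h] inverse. *)
Lemma fiber_rank_matching (S T : finType) (f : S -> U) (h : T -> U) :
    (forall u, #|fiber f u| = #|fiber h u|) ->
  exists g : S -> T, forall x, h (g x) = f x /\
    index (g x) (enum (fiber h (f x))) = index x (enum (fiber f (f x))).
Proof.
move=> eq_fh; apply: (@fin_all_exists S (fun=> T) (fun x y => h y = f x /\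
    index y (enum (fiber h (f x))) = index x (enum (fiber f (f x))))) => x.
have x_f : x \in enum (fiber f (f x)) by rewrite mem_enum inE.
have lt_x : (index x (enum (fiber f (f x))) < size (enum (fiber h (f x))))%N.
  by rewrite -cardE -eq_fh cardE index_mem.
(* [nth] needs a default in [T], which might be empty; [lt_x] forces the fiber to have an
   element. *)
have [y0 _] : exists y, y \in enum (fiber h (f x)).
  by case: (enum (fiber h _)) lt_x => // y s _; exists y; rewrite mem_head.
exists (nth y0 (enum (fiber h (f x))) (index x (enum (fiber f (f x))))).
split; last by rewrite index_uniq ?enum_uniq.
by have := mem_nth y0 lt_x; rewrite mem_enum inE => /eqP.
Qed.

Lemma fiber_bijection (S T : finType) (f : S -> U) (h : T -> U) :
    (forall u, #|fiber f u| = #|fiber h u|) ->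
  exists2 g : S -> T, bijective g & forall x, h (g x) = f x.
Proof.
move=> eq_fh.
have [g gP] := fiber_rank_matching eq_fh.
have [g' g'P] := fiber_rank_matching (fun u => esym (eq_fh u)).
exists g; last by move=> x; case: (gP x).
exists g' => [x|y].
  have [hg ix] := gP x; have [fg' iy] := g'P (g x).
  rewrite hg ix in fg' iy.
  (* [g' (g x)] and [x] occupy the same position in the same fiber of [f], hence coincide. *)
  by apply: (index_inj x) iy; rewrite mem_enum inE ?fg'.
have [fg' iy] := g'P y; have [hg ix] := gP (g' y).
rewrite fg' iy in hg ix.
by apply: (index_inj y) ix; rewrite mem_enum inE ?hg.
Qed.

End FiberMatching.

Definition memF2 (S : finType) (x : S) (A : powF2 S) : 'F_2 :=
  (x \in (A : {set S}))%:R.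

Section Membership.
Variable S : finType.
Implicit Types (x : S) (A B : powF2 S).

Lemma memF2_is_linear x : linear_for *%R (memF2 x).
Proof.
move=> k A B; rewrite /memF2 [in LHS]in_symdiff /GRing.scale /=.
case: (F2P k) => ->; rewrite /scaleF2 /= ?inE ?mul0r ?add0r ?mul1r //.
by case: (_ \in _); case: (_ \in _); apply: val_inj.
Qed.

HB.instance Definition _ x := GRing.isLinear.Build 'F_2 (powF2 S) 'F_2 *%R
  (memF2 x) (memF2_is_linear x).

Lemma memF2_eq1 x A : (memF2 x A == 1) = (x \in (A : {set S})).
Proof. by rewrite /memF2; case: (_ \in _). Qed.

Lemma powF2_ext A B : (forall x, memF2 x A = memF2 x B) -> A = B.
Proof. by move=> AB; apply/setP => x; rewrite -!memF2_eq1 AB. Qed.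

Definition membership_vector r (X : r.-tuple (powF2 S)) x : 'cV['F_2]_r :=
  \col_i memF2 x (tnth X i).

(** This turns cardinalities of regions into cardinalities of fibers, the form [fiber_bijection]
    needs. *)
Lemma venn_fiber r (X : r.-tuple (powF2 S)) a :
  venn X a = fiber (membership_vector X) a.
Proof.
apply/setP => x; rewrite !inE; apply/andP/eqP => [[/bigcapP inX /bigcapP outX]|<-].
  apply/colP => i; rewrite mxE /memF2.
  have [ai|] := boolP (a i 0 == 1); first by rewrite inX // (eqP ai).
  move=> nai; have := outX i nai; rewrite inE => /negPf->.
  by move: nai; case: (F2P (a i 0)) => ->.
by split; apply/bigcapP => i; rewrite mxE memF2_eq1 ?inE.
Qed.

End Membership.

Section Pullback.
Variables (S T : finType).

(** Direct images along a bijection are handled as preimages along its inverse, since preimages are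
    linear for every map. *)
Definition pullback (h : T -> S) (A : powF2 S) : powF2 T :=
  h @^-1: (A : {set S}).

Lemma memF2_pullback h A y : memF2 y (pullback h A) = memF2 (h y) A.
Proof. by rewrite /memF2 inE. Qed.

Lemma pullback_is_linear h : linear (pullback h).
Proof.
by move=> k A B; apply: powF2_ext => y; rewrite memF2_pullback !linearP /= !memF2_pullback.
Qed.

HB.instance Definition _ h := GRing.isLinear.Build 'F_2 (powF2 S) (powF2 T) *:%R
  (pullback h) (pullback_is_linear h).

(** Membership of [x] in a set can be read off its preimage at the point [g x]. *)
Lemma lker_pullback h g : cancel g h -> lker (linfun (pullback h)) = 0%VS.
Proof.
move=> gK; apply/eqP/lker0P => A B; rewrite !lfunE /= => AB.
by apply: powF2_ext => x; rewrite -[x]gK -!memF2_pullback AB.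
Qed.

(** An equality of set families becomes one of subspaces, open to dimension arguments. *)
Lemma isomorphism_pullback (V : {vspace powF2 S}) (W : {vspace powF2 T}) g h :
    cancel g h -> cancel h g ->
  is_isomorphism V W g <-> (linfun (pullback h) @: V)%VS = W.
Proof.
move=> gK hK.
have imgE (A : powF2 S) : g @: (A : {set S}) = linfun (pullback h) A.
  by rewrite lfunE /= /pullback (can2_imset_pre _ gK hK).
have memE B : (B \in [set g @: (A : {set S}) | A : powF2 S in V])
    = (B \in linfun (pullback h) @: V)%VS.
  by apply/imsetP/memv_imgP => -[A AV ->]; exists A.
split=> [[_ VW]|VW].
  by apply/vspaceP => B; rewrite -memE VW inE.
split; first by exists h.
by apply/setP => B; rewrite memE VW inE.
Qed.

End Pullback.

Theorem theorem4p5 (S T : finType)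
    (V : {vspace powF2 S}) (W : {vspace powF2 T}) :
  (exists g : S -> T, is_isomorphism V W g) <-> venn_linear_bijection V W.
Proof.
split=> [[g iso_g]|[r [X [Y [N [basisX basisY uN cardN]]]]]].
  have [h gK hK] := iso_g.1.
  have {iso_g} <- := (isomorphism_pullback V W gK hK).1 iso_g.
  have kerh := lker_pullback gK.
  exists (\dim V), (vbasis V), (map_tuple (linfun (pullback h)) (vbasis V)), 1%:M.
  split; rewrite ?unitmx1 ?vbasisP //.
    by rewrite limg_basis_of ?vbasisP // kerh capv0.
  (* The image under [g] of a region is its preimage under [h], so both sides count points [y] by
     the membership vector of [h y]. *)
  move=> a; rewrite mul1mx !venn_fiber -(card_imset _ (can_inj gK)).
  rewrite (can2_imset_pre _ gK hK); apply: eq_card => y; rewrite !inE.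
  congr (_ == _); apply/colP => i.
  by rewrite !mxE tnth_map lfunE /= memF2_pullback.
have [u|g [h gK hK] gN] :=
    @fiber_bijection _ S T (fun x => N *m membership_vector X x) (membership_vector Y).
  (* Invertibility of [N] makes this fiber a single region, to which [cardN] applies. *)
  have -> : fiber (fun x => N *m membership_vector X x) u = venn X (invmx N *m u).
    rewrite venn_fiber; apply/setP => x; rewrite !inE.
    by rewrite -(can2_eq (mulKmx uN) (mulKVmx uN)).
  by rewrite -cardN (mulKVmx uN) venn_fiber.
exists g; apply/(isomorphism_pullback V W gK hK)/esym/eqP.
(* Injectivity of the pullback and the common length [r] of the bases give equal dimensions, leaving
   one inclusion. *)
rewrite eqEdim limg_dim_eq ?(lker_pullback gK) ?capv0 //.
rewrite (size_basis basisX) (size_basis basisY) leqnn andbT.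
rewrite -(span_basis basisY); apply/span_subvP => _ /tnthP[i ->].
(* The coefficients are row [i] of [N]: coordinate [i] of [gN] at [h y] is the required identity at
   [y]. *)
apply/memv_imgP; exists (\sum_j N i j *: tnth X j).
  by apply: memv_suml => j _; rewrite memvZ // (basis_mem basisX) ?mem_tnth.
apply: powF2_ext => y; rewrite lfunE /= memF2_pullback linear_sum /=.
have := congr1 (fun c : 'cV_r => c i 0) (gN (h y)).
rewrite hK !mxE => ->; apply: eq_bigr => j _.
by rewrite linearZ mxE.
Qed.
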